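(* The finite projective plane $\Omega^D$ of order $9$ (the dual plane of $\Omega$) is not a Poncelet plane.
   Context: Miniquaternion near-field $\mathfrak{S}=\{0,\pm1,\pm i,\pm j,\pm k\}$: additively $\{a+bi: a,b\in GF(3)\}$ with $j:=1+i$, $k:=1-i$; multiplication on nonzero elements is the quaternion group ($i^2=j^2=k^2=-1$, $ij=k=-ji$, $jk=i=-kj$, $ki=j=-ik$, $-1$ central), $0$ absorbing. The plane $\Omega$ has points $(x,y)$ ($x,y\in\mathfrak{S}$), $(1,\mu,0)$ ($\mu\in\mathfrak{S}$), $(0,1,0)$; lines: $y=x\mu+\nu$ (the points $(x,y)$ with $y=x\mu+\nu$ and $(1,\mu,0)$), $x=\lambda$ (the points $(\lambda,y)$ and $(0,1,0)$), and the ideal line (all $(1,\mu,0)$ and $(0,1,0)$). $\Omega^D$ is the dual plane of $\Omega$: its points are the lines of $\Omega$, its lines are the points of $\Omega$, with the same incidence. An oval in a plane of order $n$ is a set of $n+1$ points no three collinear; secants/tangents of an oval are lines meeting it in two/exactly one point. For an ordered pair of ovals $(O_t,O_s)$, an $m$-sided Poncelet polygon ($3\le m\le n+1$) is a cyclically ordered $m$-tuple of distinct points of $O_s$ with every line joining cyclically consecutive vertices a tangent of $O_t$. $(O_t,O_s)$ is a Poncelet $m$-pair if an $m$-sided Poncelet polygon exists but no $m'$-sided one for $m'\neq m$, $3\le m'\le n+1$; a Poncelet $0$-pair if no secant of $O_s$ is a tangent of $O_t$; a Poncelet $\infty$-pair if some secant of $O_s$ is tangent to $O_t$ but no Poncelet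 polygon exists. A Poncelet plane is one in which every pair of ovals is a Poncelet $m$-pair ($3\le m\le n+1$), a Poncelet $0$-pair or a Poncelet $\infty$-pair. *)

(* Defs.v *)
From HB Require Import structures.
From mathcomp Require Import all_boot all_algebra.

Set Implicit Arguments.
Unset Strict Implicit.
Unset Printing Implicit Defensive.

Import GRing.Theory.
Local Open Scope ring_scope.

Section Incidence.
Variables (P L : finType) (inc : P -> L -> bool).

Definition collinear (p q r : P) : bool :=
  [exists l : L, [&& inc p l, inc q l & inc r l]].

Definition no_three_collinear (A : {set P}) : Prop :=
  forall p q r, p \in A -> q \in A -> r \in A ->
    p != q -> q != r -> p != r -> ~~ collinear p q r.

Definition meet_line (A : {set P}) (l : L) : {set P} := [set p in A | inc p l].
End Incidence.

Record projective_plane (n : nat) := ProjectivePlane {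
  point : finType;
  line : finType;
  inc : point -> line -> bool;
  join_ax : forall p q, p != q -> exists! l, inc p l && inc q l;
  meet_ax : forall l m, l != m -> exists! p, inc p l && inc p m;
  quadrangle_ax : exists2 Q : {set point}, #|Q| = 4%N & no_three_collinear inc Q;
  order_ax : forall l, #|[set p | inc p l]| = n.+1 }.

Section Duality.
Variables (n : nat) (Pi : projective_plane n).
Implicit Types (p q : point Pi) (l m : line Pi).

Definition dual_inc (l : line Pi) (p : point Pi) : bool := inc p l.

Lemma join_uniq p q l m :
  p != q -> inc p l -> inc q l -> inc p m -> inc q m -> l = m.
Proof.
move=> /join_ax[k [_ ku]] pl ql pm qm.
by rewrite -(ku l) ?pl ?ql // -(ku m) ?pm ?qm.
Qed.

Lemma meet_uniq p q l m :
  l != m -> inc p l -> inc p m -> inc q l -> inc q m -> p = q.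
Proof.
move=> /meet_ax[k [_ ku]] pl pm ql qm.
by rewrite -(ku p) ?pl ?pm // -(ku q) ?ql ?qm.
Qed.

Lemma dual_order p : #|[set l | dual_inc l p]| = n.+1.
Proof.
have [m npm] : exists m, ~~ inc p m.
  have [Q cQ arcQ] := quadrangle_ax Pi.
  have [s [us sQ ss]] : exists s, [/\ uniq s, {subset s <= Q} & size s = 4%N].
    exists (enum Q); split; rewrite ?enum_uniq -?cardE //.
    by move=> x; rewrite mem_enum.
  case: s us sQ ss => [|a [|b [|c [|d [|]]]]] //= us sQ _.
  have inQ x : x \in [:: a; b; c; d] -> x \in Q by apply: sQ.
  move: us; rewrite !inE !negb_or => /and4P[/and3P[ab ac ad] /andP[bc bd] cd _].
  have [l1 [/andP[al1 bl1] _]] := join_ax ab.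
  have [l2 [/andP[bl2 cl2] _]] := join_ax bc.
  have [l3 [/andP[cl3 dl3] _]] := join_ax cd.
  have abc : ~~ collinear (@inc n Pi) a b c.
    by apply: arcQ; rewrite ?inQ ?inE ?eqxx ?orbT.
  have bcd : ~~ collinear (@inc n Pi) b c d.
    by apply: arcQ; rewrite ?inQ ?inE ?eqxx ?orbT.
  have l12 : l1 != l2.
    by apply: contraNneq abc => e; apply/existsP; exists l1; rewrite al1 bl1 e.
  have [pl1|] := boolP (inc p l1); last by exists l1.
  have [pl2|] := boolP (inc p l2); last by exists l2.
  have pb : p = b by apply: (meet_uniq l12).
  exists l3; apply: contraNN bcd => pl3; apply/existsP; exists l3.
  by rewrite -pb pl3 cl3 dl3.
pose J q := odflt m [pick l | inc p l && inc q l].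
have neq q : inc q m -> p != q by apply: contraTneq => <-.
have JP q : inc q m -> inc p (J q) && inc q (J q).
  move=> qm; rewrite /J; case: pickP => //= none.
  by have [l [pql _]] := join_ax (neq q qm); move: (none l); rewrite pql.
rewrite -(order_ax m) -(card_in_imset (f := J) (D := [set q | inc q m])).
  apply: eq_card => l; rewrite inE /dual_inc; apply/idP/imsetP.
    move=> pl; have lm : l != m by apply: contraNneq npm => <-.
    have [q [/andP[ql qm] _]] := meet_ax lm.
    exists q; rewrite ?inE //; have /andP[pJ qJ] := JP q qm.
    exact: (join_uniq (neq q qm)).
  by case=> q; rewrite inE => /JP/andP[pJ _] ->.
move=> q r; rewrite !inE => qm rm e.
have /andP[pJ qJ] := JP q qm; have /andP[_ rJ] := JP r rm; rewrite -e in rJ.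
have Jm : J q != m by apply: contraNneq npm => <-.
exact: (meet_uniq Jm).
Qed.

Lemma dual_quadrangle :
  exists2 Q : {set line Pi}, #|Q| = 4%N & no_three_collinear dual_inc Q.
Proof.
have [Q cQ arcQ] := quadrangle_ax Pi.
have [s [us sQ ss]] : exists s, [/\ uniq s, {subset s <= Q} & size s = 4%N].
  exists (enum Q); split; rewrite ?enum_uniq -?cardE //.
  by move=> x; rewrite mem_enum.
case: s us sQ ss => [|a [|b [|c [|d [|]]]]] //= us sQ _.
have inQ x : x \in [:: a; b; c; d] -> x \in Q by apply: sQ.
move: us; rewrite !inE !negb_or => /and4P[/and3P[ab ac ad] /andP[bc bd] cd _].
have da : d != a by rewrite eq_sym.
have [k1 [/andP[ak1 bk1] _]] := join_ax ab.
have [k2 [/andP[bk2 ck2] _]] := join_ax bc.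
have [k3 [/andP[ck3 dk3] _]] := join_ax cd.
have [k4 [/andP[dk4 ak4] _]] := join_ax da.
have tri x y z k : x \in [:: a; b; c; d] -> y \in [:: a; b; c; d] ->
  z \in [:: a; b; c; d] -> x != y -> y != z -> x != z ->
  inc x k -> inc y k -> inc z k -> False.
  move=> /inQ Qx /inQ Qy /inQ Qz xy yz xz xk yk zk.
  have /negP := arcQ x y z Qx Qy Qz xy yz xz; apply.
  by apply/existsP; exists k; rewrite xk yk zk.
have [ba ca db cb dc] : [/\ b != a, c != a, d != b, c != b & d != c].
  by split; rewrite eq_sym.
have nabc k : inc a k -> inc b k -> inc c k -> False.
  by apply: tri; rewrite ?inE ?eqxx ?orbT.
have nabd k : inc a k -> inc b k -> inc d k -> False.
  by apply: tri; rewrite ?inE ?eqxx ?orbT.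
have nacd k : inc a k -> inc c k -> inc d k -> False.
  by apply: tri; rewrite ?inE ?eqxx ?orbT.
have nbcd k : inc b k -> inc c k -> inc d k -> False.
  by apply: tri; rewrite ?inE ?eqxx ?orbT.
have k12 : k1 != k2 by apply/eqP => e; apply: (nabc k1) => //; rewrite e.
have k23 : k2 != k3 by apply/eqP => e; apply: (nbcd k2) => //; rewrite e.
have k34 : k3 != k4 by apply/eqP => e; apply: (nacd k3) => //; rewrite e.
have k14 : k1 != k4 by apply/eqP => e; apply: (nabd k1) => //; rewrite e.
have k13 : k1 != k3 by apply/eqP => e; apply: (nabc k1) => //; rewrite e.
have k24 : k2 != k4 by apply/eqP => e; apply: (nbcd k2) => //; rewrite e.
have c123 p : inc p k1 -> inc p k2 -> inc p k3 -> False.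
  move=> p1 p2 p3; have e := meet_uniq k12 p1 p2 bk1 bk2; subst p.
  exact: (nbcd k3).
have c234 p : inc p k2 -> inc p k3 -> inc p k4 -> False.
  move=> p1 p2 p3; have e := meet_uniq k23 p1 p2 ck2 ck3; subst p.
  exact: (nacd k4).
have c134 p : inc p k1 -> inc p k3 -> inc p k4 -> False.
  move=> p1 p2 p3; have e := meet_uniq k34 p2 p3 dk3 dk4; subst p.
  exact: (nabd k1).
have c124 p : inc p k1 -> inc p k2 -> inc p k4 -> False.
  move=> p1 p2 p3; have e := meet_uniq k14 p1 p3 ak1 ak4; subst p.
  exact: (nabc k2).
exists [set:: [:: k1; k2; k3; k4]].
  rewrite cardsE; apply: (card_uniqP _).
  by rewrite /= !inE !negb_or k12 k13 k14 k23 k24 k34.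
move=> x y z; rewrite !inE => X Y Z xy yz xz.
apply/negP => /existsP[p /and3P[]]; rewrite /dual_inc.
move: X Y Z xy yz xz.
by do 3![case/or4P => /eqP->]; rewrite ?eqxx // => _ _ _ *;
  first [apply: (c123 p); assumption | apply: (c234 p); assumption
        |apply: (c134 p); assumption | apply: (c124 p); assumption].
Qed.

Definition dual_plane : projective_plane n :=
  @ProjectivePlane n (line Pi) (point Pi) dual_inc
    (@meet_ax n Pi) (@join_ax n Pi) dual_quadrangle dual_order.
End Duality.

Section Poncelet.
Variables (n : nat) (Pi : projective_plane n).
Implicit Types (O : {set point Pi}) (p q : point Pi) (l : line Pi).

Definition oval O : Prop :=
  #|O| = n.+1 /\ no_three_collinear (@inc n Pi) O.

Definition secant O l : bool := #|meet_line (@inc n Pi) O l| == 2%N.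
Definition tangent O l : bool := #|meet_line (@inc n Pi) O l| == 1%N.

(* Only used for p != q, in which case l is the line joining p and q. *)
Definition joined_by_tangent O p q : bool :=
  [exists l, [&& inc p l, inc q l & tangent O l]].

(* An m-gon is listed from an arbitrary starting vertex. *)
Definition poncelet_polygon (Ot Os : {set point Pi}) m
    (s : m.-tuple (point Pi)) : bool :=
  [&& 3 <= m <= n.+1, uniq s, all [in Os] s & cycle (joined_by_tangent Ot) s]%N.

Definition has_poncelet_polygon (Ot Os : {set point Pi}) (m : nat) : Prop :=
  exists s : m.-tuple (point Pi), poncelet_polygon Ot Os s.

Definition poncelet_pair (Ot Os : {set point Pi}) (m : nat) : Prop :=
  has_poncelet_polygon Ot Os m /\
  forall m', (3 <= m' <= n.+1)%N -> m' <> m -> ~ has_poncelet_polygon Ot Os m'.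

Definition poncelet_0_pair (Ot Os : {set point Pi}) : Prop :=
  forall l, secant Os l -> ~~ tangent Ot l.

Definition poncelet_infty_pair (Ot Os : {set point Pi}) : Prop :=
  (exists2 l, secant Os l & tangent Ot l) /\
  forall m, (3 <= m <= n.+1)%N -> ~ has_poncelet_polygon Ot Os m.

Definition poncelet_plane : Prop :=
  forall Ot Os, oval Ot -> oval Os ->
  [\/ exists2 m, (3 <= m <= n.+1)%N & poncelet_pair Ot Os m,
      poncelet_0_pair Ot Os | poncelet_infty_pair Ot Os].
End Poncelet.

(* The miniquaternion near-field: (a, b) stands for a + b i; the addition is
   that of the product of two copies of GF(3). *)

Definition nf : Type := ('F_3 * 'F_3)%type.

Definition nf1 : nf := (1, 0).
Definition nfi : nf := (0, 1).
Definition nfj : nf := nf1 + nfi.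
Definition nfk : nf := nf1 - nfi.

Variant quat := Q1 | Qi | Qj | Qk.

(* In (s, u) : bool * quat, the sign is negative iff s = true. *)
Definition quat_mul (u v : quat) : bool * quat :=
  match u, v with
  | Q1, _ => (false, v)
  | _, Q1 => (false, u)
  | Qi, Qi | Qj, Qj | Qk, Qk => (true, Q1)
  | Qi, Qj => (false, Qk)
  | Qj, Qi => (true, Qk)
  | Qj, Qk => (false, Qi)
  | Qk, Qj => (true, Qi)
  | Qk, Qi => (false, Qj)
  | Qi, Qk => (true, Qj)
  end.

Definition nf_of_quat (x : bool * quat) : nf :=
  let u := match x.2 with Q1 => nf1 | Qi => nfi | Qj => nfj | Qk => nfk end in
  if x.1 then - u else u.

Definition quat_of_nf (x : nf) : option (bool * quat) :=
  match val x.1, val x.2 with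
  | 0, 0 => None
  | 1, 0 => Some (false, Q1)
  | 2, 0 => Some (true, Q1)
  | 0, 1 => Some (false, Qi)
  | 0, _ => Some (true, Qi)
  | 1, 1 => Some (false, Qj)
  | 1, _ => Some (false, Qk)
  | _, 1 => Some (true, Qk)
  | _, _ => Some (true, Qj)
  end%N.

Lemma nf_of_quatK x : quat_of_nf (nf_of_quat x) = Some x.
Proof. by case: x => [[] []]. Qed.

Lemma quat_of_nfK x : oapp nf_of_quat 0 (quat_of_nf x) = x.
Proof.
by case: x => [[[|[|[|//]]] ?] [[|[|[|//]]] ?]]; apply/eqP.
Qed.

Definition nf_mul (x y : nf) : nf :=
  match quat_of_nf x, quat_of_nf y with
  | Some (s, u), Some (t, v) =>
      let: (r, w) := quat_mul u v in nf_of_quat (s (+) t (+) r, w)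
  | _, _ => 0
  end.

Definition nf_elems : seq nf :=
  [seq (a, b) : nf | a <- [:: 0; 1; 1 + 1 : 'F_3], b <- [:: 0; 1; 1 + 1 : 'F_3]].

Lemma mem_nf_elems x : x \in nf_elems.
Proof. by case: x => [[[|[|[|//]]] ?] [[|[|[|//]]] ?]]. Qed.

Lemma nf_forall3 (A : nf -> nf -> nf -> bool) :
  all (fun x => all (fun y => all (A x y) nf_elems) nf_elems) nf_elems ->
  forall x y z, A x y z.
Proof.
move=> h x y z; move/allP: h => /(_ x (mem_nf_elems x)).
by move=> /allP/(_ y (mem_nf_elems y))/allP; apply; apply: mem_nf_elems.
Qed.

Lemma nf_exists_uniq (A : pred nf) :
  has (fun m => all (fun m' => A m' == (m' == m)) nf_elems) nf_elems ->
  exists m, forall m', A m' = (m' == m).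
Proof.
move=> /hasP[m _ /allP h]; exists m => m'.
exact/eqP/h/mem_nf_elems.
Qed.

Lemma nf_solve_slope x1 x2 c : x1 != x2 ->
  exists m, forall m', (nf_mul x1 m' - nf_mul x2 m' == c) = (m' == m).
Proof.
move=> ne; apply: nf_exists_uniq; apply/implyP: ne.
move: x1 x2 c; apply: nf_forall3; vm_compute; reflexivity.
Qed.

Lemma nf_solve_point m1 m2 c : m1 != m2 ->
  exists x, forall x', (nf_mul x' m1 - nf_mul x' m2 == c) = (x' == x).
Proof.
move=> ne; apply: nf_exists_uniq; apply/implyP: ne.
move: m1 m2 c; apply: nf_forall3; vm_compute; reflexivity.
Qed.

(* Affine x y is (x, y), Slope mu is (1, mu, 0) and Vertical is (0, 1, 0);
   Sloped mu nu is y = x mu + nu and Upright lambda is x = lambda. *)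

Variant omega_point := Affine of nf & nf | Slope of nf | Vertical.

Variant omega_line := Sloped of nf & nf | Upright of nf | Ideal.

Definition omega_point_code (p : omega_point) : nf * nf + option nf :=
  match p with
  | Affine x y => inl (x, y)
  | Slope m => inr (Some m)
  | Vertical => inr None
  end.
Definition omega_point_decode (c : nf * nf + option nf) : omega_point :=
  match c with
  | inl (x, y) => Affine x y
  | inr (Some m) => Slope m
  | inr None => Vertical
  end.
Lemma omega_point_codeK : cancel omega_point_code omega_point_decode.
Proof. by case. Qed.
HB.instance Definition _ :=
  Finite.copy omega_point (can_type omega_point_codeK).

Definition omega_line_code (l : omega_line) : nf * nf + option nf :=
  match l with
  | Sloped m v => inl (m, v)
  | Upright x => inr (Some x)
  | Ideal => inr None
  end.
Definition omega_line_decode (c : nf * nf + option nf) : omega_line :=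
  match c with
  | inl (m, v) => Sloped m v
  | inr (Some x) => Upright x
  | inr None => Ideal
  end.
Lemma omega_line_codeK : cancel omega_line_code omega_line_decode.
Proof. by case. Qed.
HB.instance Definition _ :=
  Finite.copy omega_line (can_type omega_line_codeK).

Definition omega_inc (p : omega_point) (l : omega_line) : bool :=
  match p, l with
  | Affine x y, Sloped m v => y == nf_mul x m + v
  | Affine x _, Upright x' => x == x'
  | Affine _ _, Ideal => false
  | Slope m, Sloped m' _ => m == m'
  | Slope _, Upright _ => false
  | Slope _, Ideal => true
  | Vertical, Sloped _ _ => false
  | Vertical, Upright _ => true
  | Vertical, Ideal => true
  end.

Lemma nf_line_eq (y z v : nf) : (y == z + v) = (v == y - z).
Proof. by rewrite addrC -subr_eq eq_sym. Qed.

Lemma nf_join_eq (a b v y1 y2 : nf) :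
  (y1 == a + v) && (y2 == b + v) = (a - b == y1 - y2) && (v == y1 - a).
Proof.
rewrite nf_line_eq andbC; have [->|_] := eqVneq v (y1 - a); last by rewrite !andbF.
by rewrite !andbT -[RHS]eqr_opp !opprB [RHS]eq_sym subr_eq addrA addrAC.
Qed.

Lemma nf_meet_eq (a b v1 v2 y : nf) :
  (y == a + v1) && (y == b + v2) = (a - b == v2 - v1) && (y == a + v1).
Proof.
rewrite andbC; have [->|_] := eqVneq y (a + v1); last by rewrite !andbF.
by rewrite !andbT [RHS]subr_eq addrAC [v2 + b]addrC [RHS]eq_sym subr_eq eq_sym.
Qed.

Lemma omega_join (p q : omega_point) :
  p != q -> exists! l, omega_inc p l && omega_inc q l.
Proof.
have AS x y m : exists! l, omega_inc (Affine x y) l && omega_inc (Slope m) l.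
  exists (Sloped m (y - nf_mul x m)); split=> [|[m' v|x'|]] //=.
  - by rewrite nf_line_eq !eqxx.
  - by rewrite nf_line_eq => /andP[/eqP-> /eqP->].
  - by rewrite andbF.
have AV x y : exists! l, omega_inc (Affine x y) l && omega_inc Vertical l.
  exists (Upright x); split=> [|[m' v|x'|]] //=; rewrite ?eqxx ?andbF //.
  by move=> /andP[/eqP->].
have SV m : exists! l, omega_inc (Slope m) l && omega_inc Vertical l.
  by exists Ideal; split=> [|[m' v|x'|]] //=; rewrite ?andbF.
have sym r s : (exists! l, omega_inc r l && omega_inc s l) ->
    exists! l, omega_inc s l && omega_inc r l.
  case=> l [h u]; exists l; split; first by rewrite andbC.
  by move=> l'; rewrite andbC; apply: u.
case: p q => [x1 y1|m1|] [x2 y2|m2|] ne //; try by [|apply: sym].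
- have [ex|nx] := eqVneq x1 x2.
    subst x2; exists (Upright x1); split=> [|[m v|x'|]] //=; rewrite ?eqxx //.
      by move=> /andP[/eqP e1 /eqP e2]; rewrite e1 e2 eqxx in ne.
    by move=> /andP[/eqP->].
  have [m mP] := nf_solve_slope (y1 - y2) nx.
  have fP m' v : omega_inc (Affine x1 y1) (Sloped m' v) &&
      omega_inc (Affine x2 y2) (Sloped m' v) =
      (m' == m) && (v == y1 - nf_mul x1 m').
    by rewrite -mP; apply: nf_join_eq.
  exists (Sloped m (y1 - nf_mul x1 m)); split=> [|[m' v|x'|]].
  + by rewrite fP !eqxx.
  + by rewrite fP => /andP[/eqP-> /eqP->].
  + by move=> /= /andP[/eqP e1 /eqP e2]; rewrite e1 e2 eqxx in nx.
  + by [].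
- exists Ideal; split=> [|[m v|x'|]] //=.
  by move=> /andP[/eqP e1 /eqP e2]; rewrite e1 e2 eqxx in ne.
Qed.

Lemma omega_meet (l m : omega_line) :
  l != m -> exists! p, omega_inc p l && omega_inc p m.
Proof.
have SU m1 v x : exists! p, omega_inc p (Sloped m1 v) && omega_inc p (Upright x).
  exists (Affine x (nf_mul x m1 + v)); split=> [|[x' y'|m'|]] //=.
  - by rewrite !eqxx.
  - by move=> /andP[/eqP-> /eqP->].
  - by rewrite andbF.
have SI m1 v : exists! p, omega_inc p (Sloped m1 v) && omega_inc p Ideal.
  exists (Slope m1); split=> [|[x' y'|m'|]] //=; rewrite ?eqxx ?andbF //.
  by move=> /andP[/eqP->].
have UI x : exists! p, omega_inc p (Upright x) && omega_inc p Ideal.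
  by exists Vertical; split=> [|[x' y'|m'|]] //=; rewrite ?andbF.
have sym r s : (exists! p, omega_inc p r && omega_inc p s) ->
    exists! p, omega_inc p s && omega_inc p r.
  case=> p [h u]; exists p; split; first by rewrite andbC.
  by move=> p'; rewrite andbC; apply: u.
case: l m => [m1 v1|x1|] [m2 v2|x2|] ne //; try by [|apply: sym].
- have [em|nm] := eqVneq m1 m2.
    subst m2; exists (Slope m1); split=> [|[x y|m'|]] //=; rewrite ?eqxx //.
      move=> /andP[/eqP-> /eqP/addrI e2]; by rewrite e2 eqxx in ne.
    by move=> /andP[/eqP->].
  have [x xP] := nf_solve_point (v2 - v1) nm.
  have fP x' y : omega_inc (Affine x' y) (Sloped m1 v1) &&
      omega_inc (Affine x' y) (Sloped m2 v2) =
      (x' == x) && (y == nf_mul x' m1 + v1).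
    by rewrite -xP; apply: nf_meet_eq.
  exists (Affine x (nf_mul x m1 + v1)); split=> [|[x' y|m'|]].
  + by rewrite fP !eqxx.
  + by rewrite fP => /andP[/eqP-> /eqP->].
  + by move=> /= /andP[/eqP e1 /eqP e2]; rewrite -e1 -e2 eqxx in nm.
  + by [].
- exists Vertical; split=> [|[x y|m|]] //=.
  by move=> /andP[/eqP e1 /eqP e2]; rewrite -e1 -e2 eqxx in ne.
Qed.

Lemma omega_order (l : omega_line) : #|[set p | omega_inc p l]| = 10%N.
Proof.
have c10 : #|{: option nf}| = 10%N.
  by rewrite card_option card_prod !card_Fp.
pose f (o : option nf) : omega_point :=
  match l, o with
  | Sloped m v, Some x => Affine x (nf_mul x m + v)
  | Sloped m v, None => Slope m
  | Upright x, Some y => Affine x y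
  | Ideal, Some m => Slope m
  | _, None => Vertical
  end.
have f_inj : injective f.
  by rewrite /f; case: (l) => [m v|x|] [a|] [b|] //= [->].
rewrite -c10 -(card_imset _ f_inj); apply: eq_card => p; rewrite inE.
apply/idP/imsetP => [|[o _ ->]]; rewrite /f.
  case: (l) p => [m v|x|] [x' y|m'|] //= => [/eqP->|/eqP->|/eqP->|_|_|_].
  - by exists (Some x').
  - by exists None.
  - by exists (Some y).
  - by exists None.
  - by exists (Some m').
  - by exists None.
by case: (l) o => [m v|x|] [a|] /=.
Qed.

Definition omega_quad : seq omega_point :=
  [:: Affine 0 0; Affine 0 nf1; Affine nf1 0; Affine nf1 nf1].

Lemma omega_quadrangle : exists2 Q : {set omega_point},
  #|Q| = 4%N & no_three_collinear omega_inc Q.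
Proof.
exists [set:: omega_quad]; first by rewrite cardsE; apply/card_uniqP.
move=> p q r; rewrite !inE => Qp Qq Qr pq qr pr; apply/existsP => -[l].
case/and3P=> pl ql rl.
have: (3 <= size [seq x <- omega_quad | omega_inc x l])%N.
  apply: (@uniq_leq_size _ [:: p; q; r]).
    by rewrite /= !inE negb_or pq pr qr.
  move=> x; rewrite mem_filter !inE.
  by case/or3P => /eqP->; rewrite ?pl ?ql ?rl /=.
rewrite size_filter leqNgt => /negP; apply.
have sloped m v : (count (omega_inc^~ (Sloped m v)) omega_quad < 3)%N.
  move: (0 : nf) m v; apply: (@nf_forall3 (fun _ m v => _)); vm_compute.
  reflexivity.
have upright x : (count (omega_inc^~ (Upright x)) omega_quad < 3)%N.
  move: (0 : nf) (0 : nf) x; apply: (@nf_forall3 (fun _ _ x => _)); vm_compute.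
  reflexivity.
by case: (l).
Qed.

Definition Omega : projective_plane 9 :=
  ProjectivePlane omega_join omega_meet omega_quadrangle omega_order.

(* Main.v *)
Require Import Defs.
From mathcomp Require Import all_boot all_algebra.

Set Implicit Arguments.
Unset Strict Implicit.
Unset Printing Implicit Defensive.

(** In a Poncelet plane, all Poncelet polygons of a given pair of ovals have
    the same number of sides.  In the dual of Omega, a computer search yields a
    pair of ovals that has both a triangle and a pentagon. *)

(** Replaces a cardinality over a finite type by a count along an explicit list, which [vm_compute]
    can evaluate. *)
Lemma card_meet_line (P L : finType) (inc : P -> L -> bool) (s : seq P) (l : L) :
  uniq s -> #|meet_line inc [set:: s] l| = count (inc^~ l) s.
Proof.
move=> us; rewrite -size_filter -(card_uniqP (filter_uniq _ us)).
by apply: eq_card => p; rewrite inE mem_filter inE andbC.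
Qed.

Section Plane.
Variables (n : nat) (Pi : projective_plane n).
Implicit Types (O : {set point Pi}) (s : seq (point Pi)) (l : line Pi).

(** With this form the oval test is one count per line rather than a search over triples of
    points. *)
Lemma no_three_collinearP O :
  (forall l, #|meet_line (@inc n Pi) O l| <= 2) <->
  no_three_collinear (@inc n Pi) O.
Proof.
split=> [le2 p q r Op Oq Or pq qr pr | arc l].
  apply/existsP => -[l /and3P[pl ql rl]]; have := le2 l.
  rewrite leqNgt => /negP; apply; apply/card_gt2P.
  by exists p, q, r; split; split; rewrite // ?inE ?Op ?Oq ?Or // eq_sym.
rewrite leqNgt; apply/negP => /card_gt2P[p [q [r [[]]]]].
rewrite !inE => /andP[Op pl] /andP[Oq ql] /andP[Or rl] [pq qr rp].
rewrite eq_sym in rp; have /existsP[] := arc p q r Op Oq Or pq qr rp.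
by exists l; rewrite pl ql.
Qed.

Lemma oval_set_seq s : uniq s -> size s = n.+1 ->
  (forall l, count ((@inc n Pi)^~ l) s <= 2) -> oval [set:: s].
Proof.
move=> us ss le2; split; first by rewrite cardsE (card_uniqP us).
by apply/no_three_collinearP => l; rewrite card_meet_line.
Qed.

(** An inclusion is enough to exhibit polygons, so [ls] may be any list of candidate lines; a hit in
    it is a witness. *)
Lemma joined_by_tangent_set_seq s (ls : seq (line Pi)) : uniq s ->
  subrel
    (fun p q => has (fun l =>
       [&& inc p l, inc q l & count ((@inc n Pi)^~ l) s == 1]) ls)
    (joined_by_tangent [set:: s]).
Proof.
move=> us p q /hasP[l _ /and3P[pl ql tl]]; apply/existsP; exists l.
by rewrite /tangent card_meet_line // pl ql.
Qed.

(** The first side works: it is tangent to [Ot] and contains two distinct vertices in [Os], and an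
    oval has at most two points on a line. *)
Lemma poncelet_polygon_tangent_secant (Ot Os : {set point Pi}) m :
  oval Os -> has_poncelet_polygon Ot Os m ->
  exists2 l, secant Os l & tangent Ot l.
Proof.
move=> [_ /no_three_collinearP le2] [s /and4P[/andP[m3 _] us sO cs]].
move: us sO cs (size_tuple s); case: (tval s) => [|p [|q s']] //=.
(* Lists with fewer than two vertices contradict [3 <= m]. *)
- by move=> _ _ _ e; rewrite -e in m3.
- by move=> _ _ _ e; rewrite -e in m3.
rewrite !inE negb_or => /andP[/andP[pq _] _] /and3P[Op Oq _].
case/andP=> /existsP[l /and3P[pl ql tl]] _ _; exists l => //.
rewrite /secant eqn_leq le2; apply/card_gt1P; exists p, q.
by split; rewrite // inE ?Op ?Oq.
Qed.

(** A polygon rules out a 0-pair, by its first side, and an infinity-pair, by definition; in a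
    [k]-pair both sizes equal [k]. *)
Lemma poncelet_plane_polygon_size (Ot Os : {set point Pi}) m m' :
  poncelet_plane Pi -> oval Ot -> oval Os ->
  has_poncelet_polygon Ot Os m -> has_poncelet_polygon Ot Os m' -> m = m'.
Proof.
move=> pon ovt ovs pm pm'.
have bound k : has_poncelet_polygon Ot Os k -> 3 <= k <= n.+1.
  by case=> s /and4P[].
have [[k _ [_ only]]|none|[_ none]] := pon _ _ ovt ovs.
- have eqk i : has_poncelet_polygon Ot Os i -> i = k.
    by move=> pi; apply/eqP/negP => /negP/eqP/(only _ (bound _ pi)).
  by rewrite (eqk m) // (eqk m').
- have [l sl tl] := poncelet_polygon_tangent_secant ovs pm.
  by move: (none l sl); rewrite tl.
- by have := none m (bound _ pm) pm.
Qed.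

End Plane.

(** The points of [Omega] are the lines of its dual, so this makes a statement about all dual lines
    computable. *)
Lemma omega_point_forall (A : pred omega_point) :
  all (fun x => all (fun y => A (Affine x y)) nf_elems && A (Slope x)) nf_elems ->
  A Vertical -> forall p, A p.
Proof.
move=> /allP h hV [x y|m|//].
  by have /andP[/allP/(_ y (mem_nf_elems y))] := h x (mem_nf_elems x).
by have /andP[] := h m (mem_nf_elems m).
Qed.

Definition omega_points : seq omega_point :=
  Vertical :: [seq Slope m | m <- nf_elems]
    ++ [seq Affine x y | x <- nf_elems, y <- nf_elems].

Local Open Scope ring_scope.

(** This list plays [Ot] and [secant_oval] plays [Os]. As dual ovals they are sets of ten lines of
    [Omega], no three concurrent. *)
Definition tangent_oval : seq omega_line :=
  [:: Sloped nfi (- nfj); Sloped (- nfi) nfi; Sloped nf1 0; Sloped nf1 nfi;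
      Sloped nfj (- nfk); Sloped nfj (- nfj); Sloped (- nf1) 0;
      Sloped (- nf1) nfk; Sloped (- nfj) nfk; Sloped (- nfj) (- nfk)].

Definition secant_oval : seq omega_line :=
  [:: Sloped nfi 0; Sloped nfi nfj; Sloped (- nfi) nfj; Sloped (- nfi) (- nfk);
      Sloped nfj (- nf1); Sloped nfk nfi; Sloped nfk (- nf1);
      Sloped (- nfk) nfi; Sloped (- nfk) (- nfk); Sloped (- nfj) 0].

(** The closing side is [Slope nfi]: the first and last vertices have slope [nfi], as does exactly
    one line of [tangent_oval]. *)
Definition triangle : 3.-tuple omega_line :=
  [tuple Sloped nfi 0; Sloped nfj (- nf1); Sloped nfi nfj].

Definition pentagon : 5.-tuple omega_line :=
  [tuple Sloped (- nfi) nfj; Sloped nfk (- nf1); Sloped (- nfj) 0;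
      Sloped nfk nfi; Sloped (- nfi) (- nfk)].

Lemma uniq_tangent_oval : uniq tangent_oval.
Proof. by vm_compute. Qed.

Lemma oval_tangent_oval : oval (Pi := dual_plane Omega) [set:: tangent_oval].
Proof.
by apply: oval_set_seq => //; apply: omega_point_forall; vm_compute.
Qed.

Lemma oval_secant_oval : oval (Pi := dual_plane Omega) [set:: secant_oval].
Proof.
by apply: oval_set_seq => //; apply: omega_point_forall; vm_compute.
Qed.

Lemma has_triangle : has_poncelet_polygon (Pi := dual_plane Omega)
  [set:: tangent_oval] [set:: secant_oval] 3.
Proof.
exists triangle; apply/and4P; split=> //; first by rewrite /= !inE !eqxx ?orbT.
have join := @joined_by_tangent_set_seq _ (dual_plane Omega) _ omega_points
  uniq_tangent_oval.
(* Each side is now found by searching the list [omega_points] instead of an existential over a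
   finite type. *)
by apply: (sub_cycle join); vm_compute.
Qed.

Lemma has_pentagon : has_poncelet_polygon (Pi := dual_plane Omega)
  [set:: tangent_oval] [set:: secant_oval] 5.
Proof.
exists pentagon; apply/and4P; split=> //; first by rewrite /= !inE !eqxx ?orbT.
have join := @joined_by_tangent_set_seq _ (dual_plane Omega) _ omega_points
  uniq_tangent_oval.
by apply: (sub_cycle join); vm_compute.
Qed.

Theorem theorem11 : ~ poncelet_plane (dual_plane Omega : projective_plane 9).
Proof.
move=> pon.
by have := poncelet_plane_polygon_size pon oval_tangent_oval oval_secant_oval
  has_triangle has_pentagon.
Qed.
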